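(* Let $G=\mathrm{SL}(n,\mathbf C)$ and for $k\in\mathbf Z$ let $\Phi_k:G\to\mathfrak{sl}(n,\mathbf C)$, $\Phi_k(g)=g^k-\frac1n\operatorname{tr}(g^k)\cdot\mathbf 1$. The maps $\Phi_k$ satisfy the commutation relations $$\Phi_k\circledast\Phi_l(g)=(l-k)\,\Phi_{k+l}(g)+\frac kn\operatorname{tr}(g^l)\,\Phi_k(g)-\frac ln\operatorname{tr}(g^k)\,\Phi_l(g)$$ for all $k,l$ and $g\in G$.
   Context: For regular conjugation-equivariant maps $\Phi,\Psi:G\to\mathfrak g$, $\Phi\circledast\Psi(g)=d\Psi_g(g\Phi(g))-d\Phi_g(g\Psi(g))$, where $g\Phi(g)\in T_gG$ is the matrix product and $d\Psi_g:T_gG\to\mathfrak g$ is the differential of $\Psi$ at $g$. (If $\tilde\Phi$ denotes the conjugation-invariant vector field $\tilde\Phi f(g)=\frac{d}{dt}f(g+tg\Phi(g))|_{t=0}$ on $G$, then $[\tilde\Phi,\tilde\Psi]$ is the vector field given by $\Phi\circledast\Psi$.) *)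

(* Defs.v *)
From HB Require Import structures.
From mathcomp Require Import all_boot all_order all_algebra.
From mathcomp Require Import complex.
From mathcomp Require Import all_classical all_reals all_analysis.
(* Not imported: its notations clash with those of the analysis library. *)
From mathcomp Require mpoly.
Import (canonicals) mpoly.

Set Implicit Arguments.
Unset Strict Implicit.
Unset Printing Implicit Defensive.

Import Order.TTheory GRing.Theory Num.Theory.
Import numFieldNormedType.Exports.

Local Open Scope ring_scope.

(* The field of complex numbers. It is packed as a numFieldType because the
   canonical topology of a number field is attached to that interface; for
   R[i] it is the one given by the complex modulus. *)
Definition C (R : realType) : numFieldType := R[i].

(* SL(n.+1, C): the size of the matrices is at least 1, and in this form
   they are a unit ring, with integer powers g ^ k. *)
Record SL (R : realType) (n : nat) : Type := MkSL {
  SL_mx :> 'M[C R]_n.+1;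
  SL_det : \det SL_mx == 1 }.

HB.instance Definition _ (R : realType) (n : nat) := [isSub for @SL_mx R n].
HB.instance Definition _ (R : realType) (n : nat) :=
  [Choice of SL R n by <:].

(* sl(n.+1, C) as a complex vector space. *)
Definition traceless (R : realType) (n : nat) : pred 'M[C R]_n.+1 :=
  fun X => \tr X == 0.

Lemma traceless_submod (R : realType) (n : nat) :
  submod_closed (@traceless R n).
Proof.
split; first by rewrite /in_mem /= /traceless mxtrace0.
move=> a X Y; rewrite /in_mem /= /traceless => /eqP X0 /eqP Y0.
by rewrite mxtraceD mxtraceZ X0 Y0 mulr0 addr0.
Qed.

HB.instance Definition _ (R : realType) (n : nat) :=
  GRing.isSubmodClosed.Build (C R) 'M[C R]_n.+1 (@traceless R n)
    (@traceless_submod R n).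

Record sl (R : realType) (n : nat) : Type := Mksl {
  sl_mx :> 'M[C R]_n.+1;
  sl_tr : traceless sl_mx }.

HB.instance Definition _ (R : realType) (n : nat) := [isSub for @sl_mx R n].
HB.instance Definition _ (R : realType) (n : nat) :=
  [Choice of sl R n by <:].
HB.instance Definition _ (R : realType) (n : nat) :=
  [SubChoice_isSubZmodule of sl R n by <:].
HB.instance Definition _ (R : realType) (n : nat) :=
  [SubZmodule_isSubLmodule of sl R n by <:].

Lemma SL_detE (R : realType) (n : nat) (g : SL R n) : \det (SL_mx g) = 1.
Proof. exact/eqP/SL_det. Qed.

Lemma SL_unit (R : realType) (n : nat) (g : SL R n) :
  SL_mx g \is a GRing.unit.
Proof. by rewrite unitmxE SL_detE unitr1. Qed.

Lemma SL_conj_subproof (R : realType) (n : nat) (h g : SL R n) :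
  \det (SL_mx h * SL_mx g * (SL_mx h)^-1) == 1.
Proof.
by rewrite !det_mulmx det_inv !SL_detE invr1 !mulr1.
Qed.

Definition SL_conj (R : realType) (n : nat) (h g : SL R n) : SL R n :=
  MkSL (SL_conj_subproof h g).

(* The coordinate ring of SL(n.+1, C) is the polynomial ring in the matrix
   entries modulo det - 1, so that its regular functions are the restrictions
   of the polynomials in the matrix entries. *)
Definition regular_fun (R : realType) (n : nat) (f : SL R n -> C R) : Prop :=
  exists p : mpoly.mpoly (n.+1 * n.+1) (C R),
    forall g : SL R n, f g = mpoly.meval (fun i => mxvec (SL_mx g) 0 i) p.

Record eqvmap (R : realType) (n : nat) : Type := MkEqvmap {
  eqv_fun :> SL R n -> sl R n;
  eqv_regular : forall i j, regular_fun (fun g => sl_mx (eqv_fun g) i j);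
  eqv_conj : forall h g : SL R n,
    sl_mx (eqv_fun (SL_conj h g)) =
      SL_mx h * sl_mx (eqv_fun g) * (SL_mx h)^-1 }.

(* gamma is a curve in SL(n.+1, C), with complex parameter, through g with
   velocity v there. Only the germ of gamma at 0 matters, so that considering
   curves defined on the whole of C is no restriction. The tangent space of
   SL(n.+1, C) at g consists of the velocities of such curves. *)
Definition curve_at (R : realType) (n : nat)
    (g : SL R n) (v : 'M[C R]_n.+1) (gamma : C R -> SL R n) : Prop :=
  gamma 0 = g /\
  is_derive (0 : C R) (1 : C R) (fun t : C R => SL_mx (gamma t)) v.

(* The differential at g of a map Psi from SL(n.+1, C) to sl(n.+1, C), which
   takes the velocity v at 0 of a curve gamma in the group to the velocity
   at 0 of the curve Psi o gamma. For Psi regular and v in the tangent space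
   at g there is exactly one such w; outside the tangent space, the value
   is 0 by convention. *)
Definition differential (R : realType) (n : nat)
    (Psi : SL R n -> sl R n) (g : SL R n) (v : 'M[C R]_n.+1) : sl R n :=
  xget 0 [set w : sl R n | exists gamma : C R -> SL R n,
    curve_at g v gamma /\
    is_derive (0 : C R) (1 : C R)
      (fun t : C R => sl_mx (Psi (gamma t))) (sl_mx w)]%classic.

Definition circledast (R : realType) (n : nat) (Phi Psi : eqvmap R n)
    (g : SL R n) : sl R n :=
  differential Psi g (SL_mx g * sl_mx (Phi g)) -
  differential Phi g (SL_mx g * sl_mx (Psi g)).

Lemma exprz_Negz (U : unitRingType) (x : U) (m : nat) :
  x ^ Negz m = x^-1 ^+ m.+1.
Proof. by rewrite NegzE exprVn. Qed.

Lemma conj_exprz (U : unitRingType) (h g : U) (k : int) :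
  h \is a GRing.unit -> g \is a GRing.unit ->
  (h * g * h^-1) ^ k = h * g ^ k * h^-1.
Proof.
move=> hu gu.
have cexp (x : U) m : (h * x * h^-1) ^+ m = h * x ^+ m * h^-1.
  elim: m => [|m IH]; first by rewrite !expr0 mulr1 mulrV.
  by rewrite !exprS IH !mulrA mulrVK.
case: k => m; first exact: cexp.
rewrite !exprz_Negz -cexp.
by rewrite !invrM ?unitrMl ?unitrV // invrK mulrA.
Qed.

Section Phi.
Variables (R : realType) (n : nat).

Lemma Phi_subproof (k : int) (g : SL R n) :
  traceless (SL_mx g ^ k - (n.+1%:R^-1 * \tr (SL_mx g ^ k))%:M).
Proof.
rewrite /traceless raddfB /= mxtrace_scalar -[X in _ - X]mulr_natr.
by rewrite mulrAC mulVf ?mul1r ?subrr ?pnatr_eq0.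
Qed.

Definition Phi_fun (k : int) (g : SL R n) : sl R n := Mksl (Phi_subproof k g).

Lemma regular_cst (c : C R) : regular_fun (fun _ : SL R n => c).
Proof. by exists (mpoly.mpolyC _ c) => g; rewrite mpoly.mevalC. Qed.

Lemma regular_entry i j : regular_fun (fun g : SL R n => SL_mx g i j).
Proof.
exists (mpoly.mpolyX (C R) (mpoly.mnm1 (mxvec_index i j))) => g.
by rewrite mpoly.mevalXU mxvecE.
Qed.

Lemma regular_add (f1 f2 : SL R n -> C R) :
  regular_fun f1 -> regular_fun f2 -> regular_fun (fun g => f1 g + f2 g).
Proof.
by move=> [p1 e1] [p2 e2]; exists (p1 + p2) => g; rewrite mpoly.mevalD -e1 -e2.
Qed.

Lemma regular_mul (f1 f2 : SL R n -> C R) :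
  regular_fun f1 -> regular_fun f2 -> regular_fun (fun g => f1 g * f2 g).
Proof.
by move=> [p1 e1] [p2 e2]; exists (p1 * p2) => g; rewrite mpoly.mevalM -e1 -e2.
Qed.

Lemma regular_ext (f1 f2 : SL R n -> C R) :
  f1 =1 f2 -> regular_fun f1 -> regular_fun f2.
Proof. by move=> e [p ep]; exists p => g; rewrite -e. Qed.

Lemma regular_sum (I : Type) (r : seq I) (P : pred I) (f : I -> SL R n -> C R) :
  (forall i, regular_fun (f i)) ->
  regular_fun (fun g => \sum_(i <- r | P i) f i g).
Proof.
move=> rf; elim: r => [|i r IH].
  by apply: regular_ext (regular_cst 0) => g; rewrite big_nil.
case Pi : (P i).
  by apply: regular_ext (regular_add (rf i) IH) => g; rewrite big_cons Pi.
by apply: regular_ext IH => g; rewrite big_cons Pi.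
Qed.

Lemma regular_prod (I : Type) (r : seq I) (P : pred I) (f : I -> SL R n -> C R) :
  (forall i, regular_fun (f i)) ->
  regular_fun (fun g => \prod_(i <- r | P i) f i g).
Proof.
move=> rf; elim: r => [|i r IH].
  by apply: regular_ext (regular_cst 1) => g; rewrite big_nil.
case Pi : (P i).
  by apply: regular_ext (regular_mul (rf i) IH) => g; rewrite big_cons Pi.
by apply: regular_ext IH => g; rewrite big_cons Pi.
Qed.

Lemma regular_exp (F : SL R n -> 'M[C R]_n.+1) (m : nat) :
  (forall i j, regular_fun (fun g => F g i j)) ->
  forall i j, regular_fun (fun g => (F g ^+ m) i j).
Proof.
move=> rF; elim: m => [|m IH] i j.
  by apply: regular_ext (regular_cst ((i == j)%:R)) => g; rewrite expr0 mxE.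
apply: (@regular_ext (fun g => \sum_k F g i k * (F g ^+ m) k j)).
  by move=> g; rewrite exprS mxE.
by apply: regular_sum => k; apply: regular_mul.
Qed.

Lemma regular_inv i j : regular_fun (fun g : SL R n => (SL_mx g)^-1 i j).
Proof.
apply: (@regular_ext (fun g => cofactor (SL_mx g) j i)).
  move=> g; rewrite /GRing.inv /= /invmx.
  by have := SL_unit g; rewrite unitmxE -/(SL_mx g \in unitmx) => ->;
     rewrite SL_detE invr1 scale1r mxE.
apply: regular_mul; first exact: regular_cst.
apply: regular_sum => s; apply: regular_mul; first exact: regular_cst.
apply: regular_prod => k.
move: (perm.fun_of_perm.body s k) => l.
apply: regular_ext (regular_entry (lift j k) (lift i l)) => g.
by rewrite !mxE.
Qed.

Lemma regular_exprz (k : int) i j :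
  regular_fun (fun g : SL R n => (SL_mx g ^ k) i j).
Proof.
case: k => m; first exact: regular_exp regular_entry i j.
apply: (@regular_ext (fun g => ((SL_mx g)^-1 ^+ m.+1) i j)).
  by move=> g; rewrite exprz_Negz.
exact: regular_exp regular_inv i j.
Qed.

Lemma Phi_regular (k : int) i j :
  regular_fun (fun g => sl_mx (Phi_fun k g) i j).
Proof.
apply: (@regular_ext (fun g => (SL_mx g ^ k) i j +
   (- (n.+1%:R^-1) * (i == j)%:R) * \sum_l (SL_mx g ^ k) l l)).
  move=> g; rewrite /= !mxE; congr (_ + _); case: (i == j).
    by rewrite mulr1n mulr1 mulNr.
  by rewrite mulr0n mulr0 mul0r oppr0.
apply: regular_add; first exact: regular_exprz.
apply: regular_mul; first exact: regular_cst.
by apply: regular_sum => l; apply: regular_exprz.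
Qed.

Lemma Phi_conj (k : int) (h g : SL R n) :
  sl_mx (Phi_fun k (SL_conj h g)) =
    SL_mx h * sl_mx (Phi_fun k g) * (SL_mx h)^-1.
Proof.
rewrite /= conj_exprz ?SL_unit // mulrBr mulrBl; congr (_ - _).
have -> : \tr (SL_mx h * SL_mx g ^ k * (SL_mx h)^-1) = \tr (SL_mx g ^ k).
  by rewrite -[_ * _ * _]/(_ *m _) mxtrace_mulC -[_ *m _]/(_ * _) mulrA mulVr ?mul1r ?SL_unit.
set a : C R := _ * _.
have -> : SL_mx h * a%:M = a%:M * SL_mx h by rewrite -[LHS]/(_ *m _) scalar_mxC.
by rewrite -mulrA mulrV ?mulr1 ?SL_unit.
Qed.

Definition Phi (k : int) : eqvmap R n := MkEqvmap (Phi_regular k) (Phi_conj k).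

End Phi.

(* Main.v *)
(* If X is traceless and commutes with g, then along any curve gamma in the
   group with gamma(0) = g and gamma'(0) = gX, the power gamma^l has velocity
   l g^l X at 0. For X = Phi_k(g) = g^k - c 1 with c = tr(g^k)/n, projecting
   l (g^(k+l) - c g^l) to the traceless matrices gives
   d(Phi_l)_g (g Phi_k(g)) = l Phi_(k+l)(g) - l c Phi_l(g),
   and the relation follows by antisymmetrising. A curve with velocity gX is
   g (1 + tX), corrected in its first column by 1 / det(1 + tX); this does not
   change the velocity because det(1 + tX) has derivative tr X = 0. *)
Require Import Defs.
From HB Require Import structures.
From mathcomp Require Import all_boot all_order all_algebra perm.
From mathcomp Require Import complex.
From mathcomp Require Import all_classical all_reals all_analysis.
Set Implicit Arguments.
Unset Strict Implicit.
Unset Printing Implicit Defensive.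

Import GRing.Theory.
Local Open Scope ring_scope.
Import Order.TTheory Num.Theory numFieldNormedType.Exports.
Local Open Scope classical_set_scope.

(** * Derivatives of matrices, products and determinants *)

Lemma is_deriveP (K : numFieldType) (V W : normedModType K) (f : V -> W)
    (a v : V) (df : W) :
  is_derive a v f df <->
  (fun h : K => h^-1 *: (f (h *: v + a) - f a)) @ 0^' --> df.
Proof.
split=> [[fd <-]|cf]; first exact: fd.
apply: DeriveDef; first by apply/cvg_ex; exists df.
exact: cvg_lim cf.
Qed.

(** Coordinates are continuous; conversely, balls of matrices are entrywise and there are finitely
    many entries, so the neighbourhoods found for each entry can be intersected. *)
Lemma is_derive_mxP (K : numFieldType) (V : normedModType K) (m n : nat)
    (M : V -> 'M[K]_(m.+1, n.+1)) (a v : V) (dM : 'M[K]_(m.+1, n.+1)) :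
  is_derive a v M dM <-> forall i j, is_derive a v (fun x => M x i j) (dM i j).
Proof.
split=> [/is_deriveP dMP i j|dMP]; apply/is_deriveP.
  rewrite [X in X @ _ --> _](_ : _ = (fun N : 'M[K]_(m.+1, n.+1) => N i j) \o
      (fun h : K => h^-1 *: (M (h *: v + a) - M a))); last first.
    by apply/funext => h; rewrite /= !mxE.
  exact: cvg_comp _ _ dMP (@coord_continuous K _ _ i j dM).
apply/cvg_ballP => e e0; near=> h.
split => // i j.
move: i j; near: h.
apply: filter_forall => i; apply: filter_forall => j.
have /is_deriveP/cvg_ballP/(_ e e0) := dMP i j.
by apply: filterS => h /=; rewrite !mxE.
Unshelve. all: by end_near.
Qed.

Lemma is_derive_bigsum (K : numFieldType) (V W : normedModType K) (I : Type)
    (r : seq I) (P : pred I) (f : I -> V -> W) (a v : V) (df : I -> W) :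
  (forall i, P i -> is_derive a v (f i) (df i)) ->
  is_derive a v (fun x => \sum_(i <- r | P i) f i x) (\sum_(i <- r | P i) df i).
Proof.
move=> fP; elim: r => [|i r IH].
  by rewrite big_nil; under eq_fun do rewrite big_nil; exact: is_derive_cst.
rewrite big_cons; under eq_fun do rewrite big_cons.
by case: ifP => // Pi; apply: is_deriveD => //; exact: fP.
Qed.

Lemma is_derive_bigprod (K : numFieldType) (V : normedModType K) (I : finType)
    (f : I -> V -> K) (a v : V) (df : I -> K) :
  (forall i, is_derive a v (f i) (df i)) ->
  is_derive a v (fun x => \prod_i f i x)
    (\sum_i df i * \prod_(j | j != i) f j a).
Proof.
move=> fP.
(* In a list without repetitions, the condition [j != i] removes exactly one factor, so induction on
   the list applies. *)
suff H (r : seq I) : uniq r -> is_derive a v (fun x => \prod_(i <- r) f i x)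
    (\sum_(i <- r) df i * \prod_(j <- r | j != i) f j a).
  by exact: H (index_enum_uniq I).
elim: r => [_|i r IH /= /andP[ir ur]].
  by rewrite big_nil; under eq_fun do rewrite big_nil; exact: is_derive_cst.
under eq_fun do rewrite big_cons.
have -> : \sum_(k <- i :: r) df k * \prod_(j <- i :: r | j != k) f j a =
    f i a *: (\sum_(k <- r) df k * \prod_(j <- r | j != k) f j a) +
    (\prod_(j <- r) f j a) *: df i.
  rewrite big_cons big_cons eqxx /= addrC; congr (_ + _).
    rewrite scaler_sumr big_seq [RHS]big_seq; apply: eq_bigr => k kr.
    rewrite big_cons ifT; first by rewrite mulrCA.
    by apply: contraNneq ir => ->.
  rewrite mulrC -[RHS]/(_ * _); congr (_ * _).
  rewrite big_seq_cond [RHS]big_seq; apply: eq_bigl => k.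
  by case: (boolP (k \in r)) => //= kr; apply: contraNneq ir => <-.
by apply: is_deriveM => //; exact: IH.
Qed.

Lemma is_derive_mulmx (K : numFieldType) (V : normedModType K) (m n p : nat)
    (A : V -> 'M[K]_(m.+1, n.+1)) (B : V -> 'M[K]_(n.+1, p.+1)) (a v : V) dA dB :
  is_derive a v A dA -> is_derive a v B dB ->
  is_derive a v (fun x => A x *m B x) (dA *m B a + A a *m dB).
Proof.
move=> /is_derive_mxP AP /is_derive_mxP BP; apply/is_derive_mxP => i j.
under eq_fun do rewrite mxE.
rewrite !mxE -big_split /=; apply: is_derive_bigsum => k _.
rewrite [X in is_derive _ _ _ X]addrC [dA i k * _]mulrC.
exact: is_deriveM.
Qed.

(** The Leibniz formula is differentiated term by term. The hypothesis is entrywise so that size 0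
    is covered: it occurs as the minor of a 1 by 1 matrix. *)
Lemma is_derive_det (K : numFieldType) (V : normedModType K) (n : nat)
    (A : V -> 'M[K]_n) (a v : V) (dA : 'M[K]_n) :
  (forall i j, is_derive a v (fun x => A x i j) (dA i j)) ->
  is_derive a v (fun x => \det (A x))
    (\sum_(s : {perm 'I_n}) (-1) ^+ s *
      \sum_i dA i (s i) * \prod_(j | j != i) A a j (s j)).
Proof.
move=> AP; apply: is_derive_bigsum => s _.
apply: (@is_deriveZ _ _ _ (fun x => \prod_i A x i (s i))).
exact: is_derive_bigprod.
Qed.

(* A permutation other than the identity moves at least two points, so only
   the diagonal product contributes to first order at the identity matrix. *)
Lemma is_derive_det1 (K : numFieldType) (V : normedModType K) (n : nat)
    (A : V -> 'M[K]_n) (a v : V) (dA : 'M[K]_n) :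
  A a = 1%:M -> (forall i j, is_derive a v (fun x => A x i j) (dA i j)) ->
  is_derive a v (fun x => \det (A x)) (\tr dA).
Proof.
move=> Aa /is_derive_det; congr is_derive.
rewrite (bigD1 (1%g : {perm 'I_n})) //= [X in _ + X]big1 ?addr0 => [|s s1].
  rewrite odd_perm1 mul1r; apply: eq_bigr => i _.
  rewrite perm1 big1 ?mulr1 // => j _.
  by rewrite perm1 Aa mxE eqxx.
rewrite big1 ?mulr0 // => i _.
(* If the moved point [k] is [i] itself, then [s k] differs from [i] and is moved too, by
   injectivity. *)
have [j ji sj] : exists2 j, j != i & s j != j.
  have [k sk] : exists k, s k != k.
    apply/existsP; apply: contraR s1; rewrite negb_exists => /forallP s1.
    apply/eqP/permP => k; rewrite perm1; apply/eqP.
    by have := s1 k; rewrite negbK.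
  have [ki|] := eqVneq k i; last by exists k.
  by exists (s k); rewrite -?ki // (inj_eq perm_inj).
by rewrite (bigD1 j) //= Aa mxE eq_sym (negbTE sj) mul0r mulr0.
Qed.

Lemma is_derive_unique (K : numFieldType) (V W : normedModType K) (f : V -> W)
    (a v : V) (df1 df2 : W) :
  is_derive a v f df1 -> is_derive a v f df2 -> df1 = df2.
Proof. by move=> [_ <-] [_ <-]. Qed.

(** By commutation every term of the product rule equals A^m X. Writing the velocity as A X avoids
    the exponent m - 1. *)
Lemma is_derive_exp (K : numFieldType) (V : normedModType K) (n : nat)
    (A : V -> 'M[K]_n.+1) (a v : V) (X : 'M[K]_n.+1) (m : nat) :
  GRing.comm (A a) X -> is_derive a v A (A a * X) ->
  is_derive a v (fun x => A x ^+ m) (A a ^+ m * X *+ m).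
Proof.
move=> AX dA; elim: m => [|m IH].
  by rewrite mulr0n; under eq_fun do rewrite expr0; exact: is_derive_cst.
under eq_fun do rewrite exprS.
have -> : A a ^+ m.+1 * X *+ m.+1 =
    A a * X * A a ^+ m + A a * (A a ^+ m * X *+ m).
  have AmX : GRing.comm (A a ^+ m) X by apply/commr_sym/commrX/commr_sym.
  have -> : A a * X * A a ^+ m = A a ^+ m.+1 * X.
    by rewrite -mulrA -AmX mulrA exprS.
  by rewrite mulrnAr mulrA -exprS mulrS.
exact: is_derive_mulmx.
Qed.

(** * Curves in the group and the velocities of their powers *)

Lemma is_derive_curve_inv (R : realType) (n : nat) (g : SL R n)
    (v : 'M[C R]_n.+1) (gamma : C R -> SL R n) :
  curve_at g v gamma ->
  is_derive (0 : C R) (1 : C R) (fun t : C R => (SL_mx (gamma t))^-1)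
    (- ((SL_mx g)^-1 * v * (SL_mx g)^-1)).
Proof.
move=> [g0 dg].
(* Differentiability first: as the determinant is 1, the entries of the inverse are cofactors, hence
   polynomial in the entries of [gamma t]. *)
have [dB dBP] : exists dB,
    is_derive (0 : C R) (1 : C R) (fun t : C R => (SL_mx (gamma t))^-1) dB.
  have /is_derive_mxP dgP := dg.
  pose d i j := 'D_1 (fun t : C R => cofactor (SL_mx (gamma t)) j i) 0.
  exists (\matrix_(i, j) d i j); apply/is_derive_mxP => i j; rewrite mxE.
  have -> : (fun t : C R => (SL_mx (gamma t))^-1 i j) =
      (fun t : C R => cofactor (SL_mx (gamma t)) j i).
    apply/funext => t; rewrite /GRing.inv /= /invmx -/(_ \in unitmx).
    by rewrite [_ \in _]SL_unit SL_detE invr1 scale1r mxE.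
  apply: derivableP; apply: ex_derive.
  apply: (@is_deriveZ _ _ _
    (fun t : C R => \det (row' j (col' i (SL_mx (gamma t)))))).
  apply: (@is_derive_det _ _ _ _ _ _ (row' j (col' i v))) => k l.
  by under eq_fun do rewrite !mxE; rewrite !mxE.
(* This product is constantly 1, so its derivative vanishes, which determines [dB]. *)
have : is_derive (0 : C R) (1 : C R)
    (fun t : C R => SL_mx (gamma t) * (SL_mx (gamma t))^-1)
    (v * (SL_mx g)^-1 + SL_mx g * dB).
  by rewrite -g0; exact: is_derive_mulmx.
under eq_fun do rewrite mulrV ?SL_unit //.
move=> /is_derive_unique /(_ (is_derive_cst _ _ _)) /eqP.
rewrite addrC addr_eq0 => /eqP gdB.
by rewrite -mulrA -mulrN -gdB mulKr ?SL_unit.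
Qed.

Lemma curve_exists (R : realType) (n : nat) (g : SL R n) (X : 'M[C R]_n.+1) :
  \tr X = 0 -> exists gamma, curve_at g (SL_mx g * X) gamma.
Proof.
move=> trX.
pose A (t : C R) : 'M[C R]_n.+1 := 1 + t *: X.
pose D (t : C R) := \det (A t).
pose E (t : C R) : 'M[C R]_n.+1 :=
  diag_mx (\row_j (if j == 0 then (D t)^-1 else 1)).
pose M (t : C R) := SL_mx g * (A t * E t).
have A0 : A 0 = 1 by rewrite /A scale0r addr0.
have D0 : D 0 = 1 by rewrite /D A0 det1.
have E0 : E 0 = 1.
  rewrite /E D0 invr1; apply/matrixP => i j; rewrite !mxE.
  by case: (_ == 0); case: (i == j).
have M0 : M 0 = SL_mx g by rewrite /M A0 E0 !mulr1.
have detM t : D t != 0 -> \det (M t) == 1.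
  move=> Dt; rewrite !det_mulmx SL_detE mul1r det_diag big_ord_recl !mxE eqxx.
  rewrite big1 => [|i _]; last by rewrite !mxE.
  by rewrite mulr1 mulfV.
have dA : is_derive (0 : C R) (1 : C R) A X.
  apply/is_derive_mxP => i j.
  have -> : (fun t : C R => A t i j) =
      cst ((1 : 'M[C R]_n.+1) i j) + (X i j *: id).
    by apply/funext => t; rewrite /= !mxE mulrC.
  rewrite [X in is_derive _ _ _ X](_ : _ = 0 + X i j * 1); last first.
    by rewrite add0r mulr1.
  exact: is_deriveD.
have dD : is_derive (0 : C R) (1 : C R) D 0.
  by move: dA => /is_derive_mxP/(is_derive_det1 A0); rewrite trX.
have dE : is_derive (0 : C R) (1 : C R) E 0.
  apply/is_derive_mxP => i j; rewrite mxE.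
  have -> : (fun t : C R => E t i j) =
     if i == j then (if i == 0 then (fun t => (D t)^-1) else cst 1) else cst 0.
    by apply/funext => t; rewrite !mxE; case: (i == j); case: (i == 0).
  case: (i == j); last exact: is_derive_cst.
  case: (i == 0); last exact: is_derive_cst.
  apply: DeriveDef; first by apply: derivableV; rewrite ?D0 ?oner_eq0 //; case: dD.
  by rewrite deriveV ?D0 ?oner_eq0 // ?derive_val ?scaler0 //; case: dD.
have dM : is_derive (0 : C R) (1 : C R) M (SL_mx g * X).
  have -> : SL_mx g * X = 0 * (A 0 * E 0) + SL_mx g * (X * E 0 + A 0 * 0).
    by rewrite E0 mul0r add0r mulr0 addr0 mulr1.
  apply: (is_derive_mulmx (A := cst (SL_mx g))); exact: is_derive_mulmx.
(* The default [g] is taken only where [D t] vanishes; by continuity of [D] this does not happen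
   near 0, so the velocity is that of [M]. *)
exists (fun t => insubd g (M t)); split.
  by apply: val_inj; rewrite val_insubd detM ?M0 // D0 oner_eq0.
apply: near_eq_is_derive dM.
have /derivable1_diffP/differentiable_continuous cD : derivable D (0 : C R) 1.
  by case: dD.
have : \forall t \near (0 : C R), D t != 0.
  by apply: cvgr_neq0 cD _; rewrite D0 oner_eq0.
by apply: filterS => t /detM Mt; rewrite -[RHS]/(val _) val_insubd Mt.
Qed.

Lemma is_derive_curve_exprz (R : realType) (n : nat) (g : SL R n)
    (X : 'M[C R]_n.+1) (gamma : C R -> SL R n) (l : int) :
  GRing.comm (SL_mx g) X -> curve_at g (SL_mx g * X) gamma ->
  is_derive (0 : C R) (1 : C R) (fun t : C R => SL_mx (gamma t) ^ l)
    (SL_mx g ^ l * X *~ l).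
Proof.
move=> gX cg; have [g0 dg] := cg; case: l => m.
  by rewrite -!exprnP -g0; apply: is_derive_exp; rewrite g0.
(* For negative exponents, the inverse curve has velocity - X g^-1 = g^-1 (- X), so the rule for
   natural powers applies with g^-1 and - X. *)
have := is_derive_curve_inv cg; rewrite mulKr ?SL_unit //.
have gVX : GRing.comm (SL_mx g)^-1 (- X).
  by apply/commrN/commr_sym/commrV/commr_sym.
rewrite -mulNr -gVX => dV.
under eq_fun do rewrite exprz_Negz.
rewrite exprz_Negz NegzE mulrNz -mulNrz -mulrN -g0.
by apply: is_derive_exp; rewrite g0.
Qed.

(** * Differentials of the maps and the commutation relation *)

(** This is the projection onto traceless matrices along the scalar ones. It sends g^l to Phi_l(g),
    so by linearity it suffices to differentiate powers. *)
Definition traceless_part (K : fieldType) (n : nat) (M : 'M[K]_n.+1) :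
    'M[K]_n.+1 := M - (n.+1%:R^-1 * \tr M)%:M.

Lemma traceless_part_is_linear (K : fieldType) (n : nat) :
  linear (@traceless_part K n).
Proof.
move=> a M N; rewrite /traceless_part mxtraceD mxtraceZ mulrDr raddfD /=.
rewrite opprD addrACA scalerBr; congr (_ - _ + _).
by rewrite mulrCA scale_scalar_mx.
Qed.

HB.instance Definition _ (K : fieldType) (n : nat) :=
  GRing.isLinear.Build K 'M[K]_n.+1 'M[K]_n.+1 _ (@traceless_part K n)
    (@traceless_part_is_linear K n).

Lemma is_derive_traceless_part (K : numFieldType) (V : normedModType K)
    (n : nat) (A : V -> 'M[K]_n.+1) (a v : V) (dA : 'M[K]_n.+1) :
  is_derive a v A dA ->
  is_derive a v (fun x => traceless_part (A x)) (traceless_part dA).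
Proof.
move=> dAP; have /is_derive_mxP dAij := dAP.
apply: is_deriveB; apply/is_derive_mxP => i j.
have dtr : is_derive a v (fun x => n.+1%:R^-1 * \tr (A x))
    (n.+1%:R^-1 * \tr dA).
  apply: (@is_deriveZ _ _ _ (fun x => \tr (A x))).
  by apply: is_derive_bigsum => k _; exact: dAij.
rewrite mxE; under eq_fun do rewrite mxE.
by case: (i == j) => //; exact: is_derive_cst.
Qed.

(** All curves with velocity g X give the same derivative, and one such curve exists, so [xget] has
    exactly one candidate. *)
Lemma differential_Phi (R : realType) (n : nat) (l : int) (g : SL R n)
    (X : 'M[C R]_n.+1) (w : sl R n) :
  GRing.comm (SL_mx g) X -> \tr X = 0 ->
  sl_mx w = traceless_part (SL_mx g ^ l * X *~ l) ->
  differential (Phi R n l) g (SL_mx g * X) = w.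
Proof.
move=> gX trX wE.
have dPhi gamma : curve_at g (SL_mx g * X) gamma ->
    is_derive (0 : C R) (1 : C R)
      (fun t : C R => sl_mx (Phi R n l (gamma t))) (sl_mx w).
  move=> cg; rewrite wE.
  exact: is_derive_traceless_part (is_derive_curve_exprz l gX cg).
apply: xget_unique => [|w' [gamma [cg dw']]].
  have [gamma cg] := curve_exists g trX.
  by exists gamma; split => //; exact: dPhi.
by apply: val_inj; apply: is_derive_unique dw' (dPhi _ cg).
Qed.

Lemma differential_Phi_Phi (R : realType) (n : nat) (k l : int) (g : SL R n) :
  differential (Phi R n l) g (SL_mx g * sl_mx (Phi R n k g)) =
    l%:~R *: Phi R n (k + l) g
    - (l%:~R / n.+1%:R * \tr (SL_mx g ^ k)) *: Phi R n l g.
Proof.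
have PhiE m : sl_mx (Phi R n m g) = traceless_part (SL_mx g ^ m) by [].
apply: differential_Phi.
- by apply: commrB; [exact: commrXz|rewrite /GRing.comm; exact: scalar_mxC].
- exact/eqP/(sl_tr (Phi R n k g)).
have -> : SL_mx g ^ l * sl_mx (Phi R n k g) =
    SL_mx g ^ (k + l) - (n.+1%:R^-1 * \tr (SL_mx g ^ k)) *: SL_mx g ^ l.
  rewrite PhiE mulrBr -exprzDr ?SL_unit // addrC [l + k]addrC [LHS]addrC.
  by congr (_ - _); exact: mul_mx_scalar.
rewrite -[in RHS]scaler_int [RHS]linearZ /= [traceless_part _]linearB /=.
by rewrite [traceless_part (_ *: _)]linearZ /= [RHS]scalerBr scalerA mulrA -!PhiE.
Qed.

Theorem theorem4p3 (R : realType) (n : nat) (k l : int) (g : SL R n) :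
  circledast (Phi R n k) (Phi R n l) g =
    (l - k)%:~R *: Phi R n (k + l) g
    + (k%:~R / n.+1%:R * \tr (SL_mx g ^ l)) *: Phi R n k g
    - (l%:~R / n.+1%:R * \tr (SL_mx g ^ k)) *: Phi R n l g.
Proof.
(* The two differentials contribute l and - k to the coefficient of Phi_(k+l)(g); the rest is
   regrouping. *)
rewrite /circledast !differential_Phi_Phi [l + k]addrC rmorphB scalerBl opprB.
by rewrite [LHS]addrACA -[RHS]addrA [RHS]addrACA [- _ - _ in LHS]addrC.
Qed.
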